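(* Let $x_0<x_1$ and $a<b<t$ be real numbers, $L=x_1-x_0$, $h=b-a$, $\Omega_{\mathrm B}=(x_0,x_1)\times(a,b)$, $\Omega_{\mathrm S}=(x_0,x_1)\times(b,t)$. Let $u_{\mathrm S}\in C^1(\overline{\Omega_{\mathrm S}};\mathbb R^2)$ and $u_{\mathrm B}\in C^1(\overline{\Omega_{\mathrm B}};\mathbb R^2)$ satisfy $\nabla\cdot u_{\mathrm S}=0$ in $\Omega_{\mathrm S}$ and $\nabla\cdot u_{\mathrm B}=0$ in $\Omega_{\mathrm B}$, normal continuity $(u_{\mathrm S})_y(x,b)=(u_{\mathrm B})_y(x,b)$ for $x_0<x<x_1$, and the prescribed velocity data $g=(g_x,g_y)$: $u_{\mathrm S}=g$ on the top edge $y=t$ and on the sides $x=x_0$ and $x=x_1$ of $\Omega_{\mathrm S}$, and $u_{\mathrm B}=g$ on the sides $x=x_0$ and $x=x_1$ of $\Omega_{\mathrm B}$. Put $D_g(y)=g_x(x_1,y)-g_x(x_0,y)$, with the data of the relevant region. Then the mean vertical velocity in $\Omega_{\mathrm B}$ is determined by the exterior data: $$\frac1{Lh}\int_{\Omega_{\mathrm B}}(u_{\mathrm B})_y\,dx\,dy=\frac1L\int_{x_0}^{x_1}g_y(x,t)\,dx+\frac1L\int_b^tD_g(s)\,ds+\frac1{Lh}\int_a^b(s-a)D_g(s)\,ds .$$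
   Context: Subscripts $x,y$ on vectors denote the horizontal and vertical components. *)

(* Defs.v *)
From HB Require Import structures.
From mathcomp Require Import all_boot all_order all_algebra.
From mathcomp Require Import all_classical all_reals all_analysis.

Set Implicit Arguments.
Unset Strict Implicit.
Unset Printing Implicit Defensive.

Import Order.TTheory GRing.Theory Num.Theory numFieldNormedType.Exports.

Local Open Scope classical_set_scope.
Local Open Scope ring_scope.

(* The plane is R * R, with p.1 horizontal and p.2 vertical. Vector fields are
   total functions whose values off the closed region of interest are never
   constrained. *)

Definition open_rect (R : realType) (x0 x1 y0 y1 : R) : set (R * R) :=
  `]x0, x1[%classic `*` `]y0, y1[%classic.

Definition partial_x (R : realType) (u : R * R -> R * R) : R * R -> R * R :=
  fun p => 'D_((1, 0) : R * R) u p.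

Definition partial_y (R : realType) (u : R * R -> R * R) : R * R -> R * R :=
  fun p => 'D_((0, 1) : R * R) u p.

Definition divergence (R : realType) (u : R * R -> R * R) (p : R * R) : R :=
  (partial_x u p).1 + (partial_y u p).2.

Definition extends_continuously (R : realType) (Omega : set (R * R))
    (f : R * R -> R * R) : Prop :=
  exists w : R * R -> R * R,
    {within closure Omega, continuous w} /\
    (forall p, Omega p -> w p = f p).

(* C^1 of the closure of an open set Omega: u is continuous on the closure, its
   first partial derivatives exist in Omega, and they extend continuously to
   the closure. *)
Definition C1_closure (R : realType) (Omega : set (R * R))
    (u : R * R -> R * R) : Prop :=
  [/\ {within closure Omega, continuous u},
      forall p, Omega p ->
        derivable u p ((1, 0) : R * R) /\ derivable u p ((0, 1) : R * R),
      extends_continuously Omega (partial_x u)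
    & extends_continuously Omega (partial_y u)].

(* The relatively open sides of two rectangles stacked on top of each other
   are disjoint, so a single g carries the data of both; the height of their
   interface, where the two data may differ, is left unconstrained. *)
Definition side_difference (R : realType) (x0 x1 : R) (g : R * R -> R * R)
    (y : R) : R :=
  (g (x1, y)).1 - (g (x0, y)).1.

(* Main.v *)
Require Import Defs.
From HB Require Import structures.
From mathcomp Require Import all_boot all_order all_algebra.
From mathcomp Require Import all_classical all_reals all_analysis.
From mathcomp Require Import measurable_realfun ring lra.

Set Implicit Arguments.
Unset Strict Implicit.
Unset Printing Implicit Defensive.

Import Order.TTheory GRing.Theory Num.Theory numFieldNormedType.Exports.

Local Open Scope classical_set_scope.
Local Open Scope ring_scope.

(** Let V(y) be the integral of the vertical component over the horizontal
    segment at height y.  Integrating the divergence-free condition over a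
    horizontal slab, with the fundamental theorem of calculus along each
    coordinate and Fubini's theorem, gives V(d) - V(c) = - int_c^d D_g.  Hence
    V is determined on the top edge, then on the interface, where normal
    continuity passes it to the lower rectangle; integrating V over (a, b) by
    parts against y - a gives the formula.  A field continuous on a closed
    rectangle extends to a continuous field on the plane by clamping the
    coordinates, so measurability for the product sigma-algebra need only be
    known for functions continuous everywhere. *)

(** * Closed rectangles as closures, and continuous extension to the plane *)

Lemma subset_closure_itvoo (R : realType) (x y : R) :
  x < y -> `[x, y]%classic `<=` closure `]x, y[%classic.
Proof.
move=> xy z; rewrite /= in_itv/= => /andP[xz zy] B /nbhs_ballP[e /= e0 eB].
(* Moving [z] towards the midpoint [c] by a fraction [s] in (0, 1] lands strictly inside. Since |c -
   z| < 2 (y - x), the bound on [s] keeps the displacement below [e]. *)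
pose c := (x + y) / 2; pose s := Num.min 1 (e / (2 * (y - x))).
have s0 : 0 < s by rewrite lt_min ltr01 divr_gt0// mulr_gt0// subr_gt0.
have s1 : s <= 1 by rewrite ge_min lexx.
have se : s * (2 * (y - x)) <= e.
  by rewrite -ler_pdivlMr ?ge_min ?lexx ?orbT// mulr_gt0// subr_gt0.
exists (z + s * (c - z)); split.
  rewrite /= in_itv/= /c; apply/andP; split; nra.
apply: eB; rewrite /ball/= opprD addrA subrr add0r normrN normrM gtr0_norm//.
apply: lt_le_trans se; rewrite ltr_pM2l// ltr_norml /c.
by apply/andP; split; lra.
Qed.

Lemma subset_closure_setX (T U : topologicalType) (A : set T) (B : set U) :
  closure A `*` closure B `<=` closure (A `*` B).
Proof.
move=> [x y] [/= Ax By] C [[P Q] /= [Px Qy] PQC].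
have [x' [Ax' Px']] := Ax _ Px; have [y' [By' Qy']] := By _ Qy.
by exists (x', y'); split => //; exact: PQC.
Qed.

Lemma subset_closure_open_rect (R : realType) (x0 x1 y0 y1 : R) :
  x0 < x1 -> y0 < y1 ->
  `[x0, x1]%classic `*` `[y0, y1]%classic `<=` closure (open_rect x0 x1 y0 y1).
Proof.
move=> x01 y01 p [p1 p2]; apply: subset_closure_setX.
by split; exact: subset_closure_itvoo.
Qed.

Definition clamp (R : realType) (a b x : R) : R := Num.min b (Num.max a x).

Lemma clamp_id (R : realType) (a b x : R) : x \in `[a, b] -> clamp a b x = x.
Proof.
by rewrite in_itv/= /clamp => /andP[ax xb]; rewrite max_r// min_r.
Qed.

Lemma clamp_itv (R : realType) (a b x : R) : a <= b -> clamp a b x \in `[a, b].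
Proof. by move=> ab; rewrite in_itv/= le_min ab le_max lexx ge_min lexx. Qed.

Lemma continuous_clamp (R : realType) (a b : R) : continuous (clamp a b).
Proof.
move=> x; apply: (@continuous_min R R (fun=> b) (fun x => Num.max a x)).
  exact: cvg_cst.
by apply: (@continuous_max R R (fun=> a) id); [exact: cvg_cst|exact: cvg_id].
Qed.

(** The extension is [u] composed with the retraction [r] of the plane onto the closed rectangle, so
    the target may be any topological space. *)
Lemma continuous_extension_rect (R : realType) (T : topologicalType)
    (x0 x1 y0 y1 : R) (u : R * R -> T) :
  x0 < x1 -> y0 < y1 ->
  {within closure (open_rect x0 x1 y0 y1), continuous u} ->
  exists2 v : R * R -> T, continuous v &
    forall x y, x \in `[x0, x1] -> y \in `[y0, y1] -> v (x, y) = u (x, y).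
Proof.
move=> x01 y01 /subspace_continuousP cu.
pose r p := (clamp x0 x1 p.1, clamp y0 y1 p.2).
have rC p : closure (open_rect x0 x1 y0 y1) (r p).
  by apply: subset_closure_open_rect => //; split; exact/clamp_itv/ltW.
exists (u \o r) => [p|x y xI yI]; last by rewrite /= /r !clamp_id.
have cr : r @ p --> r p.
  apply: (@cvg_pair _ _ _ _ (nbhs (clamp x0 x1 p.1)) (nbhs (clamp y0 y1 p.2))).
    by apply: continuous_comp; [exact: cvg_fst|exact: continuous_clamp].
  by apply: continuous_comp; [exact: cvg_snd|exact: continuous_clamp].
(* Continuity within the closure only controls [u] at nearby points of the closure; [r] takes all
   its values there, which discharges that condition. *)
move=> B /= /(cu _ (rC p)) uB.
have : nbhs p (r @^-1` [set q | closure (open_rect x0 x1 y0 y1) q -> B (u q)]).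
  exact: cr uB.
by apply: filterS => q /=; exact.
Qed.

(** * Measurability of continuous functions for the product sigma-algebra *)

Lemma open_measurable_prod (R : realType) (U : set (R * R)) :
  open U -> measurable (U : set (measurableTypeR R * measurableTypeR R)).
Proof.
move=> oU.
pose box (i : (rat * rat) * (rat * rat)) : set (R * R) :=
  `]ratr i.1.1, ratr i.1.2[ `*` `]ratr i.2.1, ratr i.2.2[.
(* An open set is the union of the rational boxes it contains. The other boxes are replaced by the
   empty set, so that the index type is the countable type of all rational quadruples. *)
have -> : U = \bigcup_i (if `[< box i `<=` U >] then box i else set0).
  apply/seteqP; split=> [[x y] Uxy|p [i _]]; last first.
    by case: ifPn => // /asboolP; exact.
  have : nbhs (x, y) U by apply: open_nbhs_nbhs.
  case=> -[P Q] /= [/nbhs_ballP[d /= d0 dP] /nbhs_ballP[e /= e0 eQ] PQU].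
  have [q1] := rat_in_itvoo (ltac:(lra) : x - d < x).
  have [q2] := rat_in_itvoo (ltac:(lra) : x < x + d).
  have [q3] := rat_in_itvoo (ltac:(lra) : y - e < y).
  have [q4] := rat_in_itvoo (ltac:(lra) : y < y + e).
  rewrite !in_itv/= => /andP[? ?] /andP[? ?] /andP[? ?] /andP[? ?].
  exists ((q1, q2), (q3, q4)) => //.
  case: ifPn => [_|/asboolP []].
    by split; rewrite /= in_itv/=; apply/andP; split; lra.
  move=> [x' y'] []; rewrite /= !in_itv/= => /andP[? ?] /andP[? ?].
  apply: PQU; split; [apply: dP|apply: eQ];
    by rewrite /ball/= ltr_norml; apply/andP; split; lra.
apply: countable_bigcupT_measurable => // i; case: ifPn => _ //.
exact: measurableX.
Qed.

Lemma continuous_measurable_fun_prod (R : realType) (f : R * R -> R) :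
  continuous f ->
  measurable_fun [set: measurableTypeR R * measurableTypeR R] f.
Proof.
move=> /continuousP cf; apply: (measurability _ (RGenOpens.measurableE R)).
move=> _ [_ [a [b ->] <-]]; rewrite setTI; apply: open_measurable_prod.
exact/cf/interval_open.
Qed.

(** * Continuity of sections and of components *)

Lemma continuous_pairl (T U V : topologicalType) (f : T * U -> V) (y : U) :
  continuous f -> continuous (fun x => f (x, y)).
Proof.
move=> cf x; apply: (@cvg_comp _ _ _ (fun x => (x, y)) f _ (nbhs (x, y))).
  by apply: (@cvg_pair _ _ _ _ (nbhs x) (nbhs y)); [exact: cvg_id|exact: cvg_cst].
exact: cf.
Qed.

Lemma continuous_pairr (T U V : topologicalType) (f : T * U -> V) (x : T) :
  continuous f -> continuous (fun y => f (x, y)).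
Proof.
move=> cf y; apply: (@cvg_comp _ _ _ (pair x) f _ (nbhs (x, y))).
  by apply: (@cvg_pair _ _ _ _ (nbhs x) (nbhs y)); [exact: cvg_cst|exact: cvg_id].
exact: cf.
Qed.

Lemma continuous_fst_comp (T U V : topologicalType) (f : T -> U * V) :
  continuous f -> continuous (fun x => (f x).1).
Proof.
move=> cf x; apply: (@cvg_comp _ _ _ f fst _ (nbhs (f x))); first exact: cf.
exact: cvg_fst.
Qed.

Lemma continuous_snd_comp (T U V : topologicalType) (f : T -> U * V) :
  continuous f -> continuous (fun x => (f x).2).
Proof.
move=> cf x; apply: (@cvg_comp _ _ _ f snd _ (nbhs (f x))); first exact: cf.
exact: cvg_snd.
Qed.

(** * Fubini's theorem over a product of bounded measurable sets *)

Section fubini_rectangle.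
Context {R : realType}.
Notation mu := (@lebesgue_measure R).
Variables (f : R * R -> R) (a b c d : R) (I J : set R).
Hypotheses (cf : continuous f).
Hypotheses (mI : measurable (I : set (measurableTypeR R))).
Hypotheses (mJ : measurable (J : set (measurableTypeR R))).
Hypotheses (Iab : I `<=` `[a, b]) (Jcd : J `<=` `[c, d]).

Let f_bounded : exists2 M, 0 < M &
  forall x y, `[a, b]%classic x -> `[c, d]%classic y -> `|f (x, y)| <= M.
Proof.
have cK : compact (`[a, b]%classic `*` `[c, d]%classic).
  by apply: compact_setX; exact: segment_compact.
have /compact_bounded[M [_ hM]] :=
  continuous_compact (continuous_subspaceT cf) cK.
(* Compactness yields a threshold [M] such that every larger number is a bound; this choice exceeds
   [M] and is positive as well. *)
exists (Num.max 1 (M + 1)); first by rewrite lt_max ltr01.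
move=> x y abx cdy; apply: (hM (Num.max 1 (M + 1))).
  by rewrite lt_max ltrDl ltr01 orbT.
by exists (x, y).
Qed.

Let mu_lt_pinfty (A : set (measurableTypeR R)) (u v : R) :
  measurable A -> A `<=` `[u, v] -> (mu A < +oo)%E.
Proof.
move=> mA Auv; apply: (@le_lt_trans _ _ (mu `[u, v]%classic)).
  by apply: le_measure => //; rewrite inE.
by apply: compact_finite_measure; exact: segment_compact.
Qed.

Lemma integrable_rect :
  (mu \x mu)%E.-integrable (I `*` J) (EFin \o f).
Proof.
have mIJ : measurable (I `*` J : set (measurableTypeR R * measurableTypeR R)).
  exact: measurableX.
have [M M0 fM] := f_bounded.
apply: measurable_bounded_integrable => //.
- rewrite [ltLHS]product_measure1E//.
  apply: lte_mul_pinfty => //; last exact: mu_lt_pinfty Jcd.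
  by rewrite ge0_fin_numE//; exact: mu_lt_pinfty Iab.
- apply: measurable_funTS; exact: continuous_measurable_fun_prod.
- exists M; split; first exact: num_real.
  move=> N MN [x y] [/= Ix Jy]; apply: (le_trans _ (ltW MN)).
  by apply: fM; [exact: Iab|exact: Jcd].
Qed.

Lemma integrable_section1 x : mu.-integrable J (fun y => (f (x, y))%:E).
Proof.
suff : mu.-integrable `[c, d] (EFin \o (fun y => f (x, y))).
  by apply: integrableS.
apply: continuous_compact_integrable; first exact: segment_compact.
apply: continuous_subspaceT; exact: continuous_pairr.
Qed.

Lemma integrable_section2 y : mu.-integrable I (fun x => (f (x, y))%:E).
Proof.
suff : mu.-integrable `[a, b] (EFin \o (fun x => f (x, y))).
  by apply: integrableS.
apply: continuous_compact_integrable; first exact: segment_compact.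
apply: continuous_subspaceT; exact: continuous_pairl.
Qed.

(** Extension by zero turns the integral over [I] times [J] into one over the whole plane, to which
    the general Fubini theorem applies. *)
Let g := (EFin \o f) \_ (I `*` J).

Let integrable_g : (mu \x mu)%E.-integrable setT g.
Proof.
apply: (proj1 (integrable_mkcond _ _) integrable_rect); exact: measurableX.
Qed.

Let F1 (x : R) : R := \int[mu]_(y in J) f (x, y).
Let F2 (y : R) : R := \int[mu]_(x in I) f (x, y).

(** For x in [I] the section is integrable, so its extended-real integral is finite and [fine] loses
    nothing; for x outside [I] the section of [g] vanishes. *)
Let g1 x : (\int[mu]_y g (x, y) = ((EFin \o F1) \_ I) x)%E.
Proof.
rewrite /g /patch; case: ifPn => [|/negP] xI.
  rewrite /= /F1 /Rintegral fineK; last first.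
    exact/integral_fune_fin_num/integrable_section1.
  rewrite [RHS]integral_mkcond; apply: eq_integral => y _.
  by rewrite /patch in_setX xI.
by apply: integral0_eq => y _; rewrite in_setX; case: ifPn => // /andP[].
Qed.

Let g2 y : (\int[mu]_x g (x, y) = ((EFin \o F2) \_ J) y)%E.
Proof.
rewrite /g /patch; case: ifPn => [|/negP] yJ.
  rewrite /= /F2 /Rintegral fineK; last first.
    exact/integral_fune_fin_num/integrable_section2.
  rewrite [RHS]integral_mkcond; apply: eq_integral => x _.
  by rewrite /patch in_setX yJ andbT.
by apply: integral0_eq => x _; rewrite in_setX; case: ifPn => // /andP[].
Qed.

Lemma Rintegral_rect1 : \int[(mu \x mu)%E]_(p in I `*` J) f p =
  \int[mu]_(x in I) \int[mu]_(y in J) f (x, y).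
Proof.
rewrite /Rintegral [in LHS]integral_mkcond -/g.
rewrite -(integral12_prod_meas1 integrable_g).
rewrite [in RHS]integral_mkcond; congr fine; apply: eq_integral => x _.
exact: g1.
Qed.

Lemma Rintegral_rect2 : \int[(mu \x mu)%E]_(p in I `*` J) f p =
  \int[mu]_(y in J) \int[mu]_(x in I) f (x, y).
Proof.
rewrite /Rintegral [in LHS]integral_mkcond -/g.
rewrite -(integral21_prod_meas1 integrable_g).
rewrite [in RHS]integral_mkcond; congr fine; apply: eq_integral => y _.
exact: g2.
Qed.

End fubini_rectangle.

(** * One-variable calculus: derivatives along sections, endpoints, integration by parts *)

(** This form fits fields that are differentiable inside a rectangle and merely continuous up to its
    edges, where the segments of integration may end. *)
Lemma Rintegral_is_derive (R : realType) (f F : R -> R) (a b : R) :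
  a < b -> {within `[a, b], continuous f} -> {within `[a, b], continuous F} ->
  (forall x, a < x < b -> is_derive x 1 F (f x)) ->
  \int[lebesgue_measure]_(x in `[a, b]) f x = F b - F a.
Proof.
move=> ab cf /(continuous_within_itvP _ ab)[_ Fa Fb] dF.
rewrite /Rintegral (@continuous_FTC2 R f F)//.
  by split => // x /[!in_itv]/= /dF [].
by move=> x /[!in_itv]/= /dF dFx; rewrite derive1E; exact: derive_val.
Qed.

(** The difference quotient of the section is the first component of the quotient of [u] in the
    direction (1, 0), and the projection is continuous. *)
Lemma is_derive_fst_pairl (R : realType) (u : R * R -> R * R) (x y : R) :
  derivable u (x, y) ((1, 0) : R * R) ->
  is_derive x (1 : R) (fun x => (u (x, y)).1) (partial_x u (x, y)).1.
Proof.
move=> du.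
have h : h^-1 *: ((u (h *: 1 + x, y)).1 - (u (x, y)).1) @[h --> 0^']
    --> (partial_x u (x, y)).1.
  apply: cvg_trans (cvg_comp _ _ du (@cvg_fst _ _ _ _ _)).
  apply: near_eq_cvg; near=> h => /=.
  suff -> : h *: ((1, 0) : R * R) + (x, y) = (h *: 1 + x, y) by [].
  by congr pair; rewrite /= (_ : h *: 0 = 0) ?add0r// scaler0.
apply: DeriveDef; first by apply/cvg_ex; exists (partial_x u (x, y)).1.
exact: cvg_lim h.
Unshelve. all: by end_near. Qed.

Lemma is_derive_snd_pairr (R : realType) (u : R * R -> R * R) (x y : R) :
  derivable u (x, y) ((0, 1) : R * R) ->
  is_derive y (1 : R) (fun y => (u (x, y)).2) (partial_y u (x, y)).2.
Proof.
move=> du.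
have h : h^-1 *: ((u (x, h *: 1 + y)).2 - (u (x, y)).2) @[h --> 0^']
    --> (partial_y u (x, y)).2.
  apply: cvg_trans (cvg_comp _ _ du (@cvg_snd _ _ _ _ _)).
  apply: near_eq_cvg; near=> h => /=.
  suff -> : h *: ((0, 1) : R * R) + (x, y) = (x, h *: 1 + y) by [].
  by congr pair; rewrite /= (_ : h *: 0 = 0) ?add0r// scaler0.
apply: DeriveDef; first by apply/cvg_ex; exists (partial_y u (x, y)).2.
exact: cvg_lim h.
Unshelve. all: by end_near. Qed.

Lemma integrable_within_continuous (R : realType) (f : R -> R) (a b : R)
    (I : set R) :
  {within `[a, b], continuous f} ->
  measurable (I : set (measurableTypeR R)) -> I `<=` `[a, b] ->
  lebesgue_measure.-integrable I (EFin \o f).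
Proof.
move=> cf mI Iab; apply: (integrableS _ mI Iab) => //.
by apply: continuous_compact_integrable => //; exact: segment_compact.
Qed.

Lemma Rintegral_itvoo_itvcc (R : realType) (f : R -> R) (a b : R) :
  lebesgue_measure.-integrable `]a, b[ (EFin \o f) ->
  \int[lebesgue_measure]_(x in `]a, b[) f x =
  \int[lebesgue_measure]_(x in `[a, b]) f x.
Proof.
move=> /measurable_int mf; rewrite /Rintegral; congr fine.
rewrite integral_itv_bndo_bndc// integral_itv_obnd_cbnd//.
exact/emeasurable_fun_itv_bndo_bndcP.
Qed.

(** Endpoints are null, and integrability of [f] on the open interval is inherited from [g]. It
    serves to replace boundary data, prescribed only on open edges, by the traces of the
    velocity. *)
Lemma eq_Rintegral_itvoo (R : realType) (f g : R -> R) (a b : R) :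
  {within `[a, b], continuous g} -> (forall x, a < x < b -> f x = g x) ->
  \int[lebesgue_measure]_(x in `[a, b]) f x =
  \int[lebesgue_measure]_(x in `]a, b[) g x.
Proof.
move=> cg fg.
have fgI : {in `]a, b[%classic : set R, f =1 g}.
  by move=> x /[!inE]/=; rewrite in_itv/=; exact: fg.
transitivity (\int[lebesgue_measure]_(x in `]a, b[) f x); last first.
  exact: eq_Rintegral.
symmetry; apply: Rintegral_itvoo_itvcc.
have : lebesgue_measure.-integrable `]a, b[ (EFin \o g).
  by apply: (integrable_within_continuous cg) => //; exact: subset_itv_oo_cc.
by apply: eq_integrable => // x xI; rewrite /= fgI.
Qed.

Lemma within_continuous_subr (R : realType) (A : set R) (a : R) :
  {within A, continuous (fun x : R => x - a)}.
Proof.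
by apply: continuous_subspaceT => x; apply: cvgB; [exact: cvg_id|exact: cvg_cst].
Qed.

Lemma Rintegral_primitive (R : realType) (D V : R -> R) (a b : R) :
  a < b -> {within `[a, b], continuous D} ->
  (forall y, a < y -> y <= b ->
    V y - V a = - \int[lebesgue_measure]_(s in `[a, y]) D s) ->
  \int[lebesgue_measure]_(y in `]a, b[) V y =
  (b - a) * V b + \int[lebesgue_measure]_(s in `]a, b[) ((s - a) * D s).
Proof.
move=> ab cD VD.
(* [V] is known only through its increments; [V a - G] has the same values on (a, b] and is visibly
   continuous and differentiable. *)
pose G y := \int[lebesgue_measure]_(s in `[a, y]) D s.
have iD : lebesgue_measure.-integrable `[a, b] (EFin \o D).
  exact: (integrable_within_continuous cD).
have cG : {within `[a, b], continuous G}.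
  exact: parameterized_integral_continuous (ltW ab) iD.
have cW : {within `[a, b], continuous (fun y => V a - G y)}.
  by move=> y; apply: cvgB; [exact: cvg_cst|exact: cG].
have cE : {within `[a, b], continuous (fun y => (y - a) * D y)}.
  by move=> y; apply: cvgM; [exact: within_continuous_subr|exact: cD].
have cF : {within `[a, b], continuous (fun y => (y - a) * (V a - G y))}.
  by move=> y; apply: cvgM; [exact: within_continuous_subr|exact: cW].
(* The product (y - a) (V a - G y) vanishes at [a] and equals (b - a) V b at [b]; its derivative is
   the difference of the two integrands in the claim. *)
have dF y : a < y < b -> is_derive y (1 : R)
    (fun y => (y - a) * (V a - G y)) ((V a - G y) - (y - a) * D y).
  move=> /andP[ay yb].
  have [cDy _ _] := (continuous_within_itvP _ ab).1 cD.
  have yab : y \in `]a, b[ by rewrite in_itv/= ay yb.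
  have [dG G'] := continuous_FTC1_closed yb iD ay (cDy _ yab).
  have hG : is_derive y (1 : R) G (D y).
    by apply: DeriveDef; [exact: dG|rewrite -derive1E].
  apply: is_derive_eq (is_deriveM
    (is_deriveB (is_derive_id y (1 : R)) (is_derive_cst a y (1 : R)))
    (is_deriveB (is_derive_cst (V a) y (1 : R)) hG)) _.
  by rewrite /GRing.scale/= !fctE; ring.
have hF := Rintegral_is_derive ab
  (fun y => cvgB (cW y) (cE y)) cF dF.
have sub : `]a, b[ `<=` (`[a, b]%classic : set R) by exact: subset_itv_oo_cc.
have VW y : a < y -> y <= b -> V y = V a - G y.
  by move=> ay yb; rewrite -(VD y ay yb); ring.
transitivity (\int[lebesgue_measure]_(y in `]a, b[) (V a - G y)).
  apply: eq_Rintegral => y /[!inE]/=; rewrite in_itv/= => /andP[ay yb].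
  exact: VW (ltW yb).
apply/eqP; rewrite -subr_eq; apply/eqP; rewrite -RintegralB//; last 2 first.
- exact: (integrable_within_continuous cW).
- exact: (integrable_within_continuous cE).
rewrite Rintegral_itvoo_itvcc; last first.
  exact: (integrable_within_continuous (fun y => cvgB (cW y) (cE y))).
by rewrite hF subrr mul0r subr0 (VW b).
Qed.

(** * Continuous and divergence-free fields on a rectangle *)

Section rectangle.
Context {R : realType}.
Notation mu := (@lebesgue_measure R).
Variables (x0 x1 y0 y1 : R).
Hypotheses (x01 : x0 < x1) (y01 : y0 < y1).
Let Omega := open_rect x0 x1 y0 y1.

Lemma within_continuous_pairl (T : topologicalType) (f : R * R -> T) (y : R) :
  {within closure Omega, continuous f} -> y \in `[y0, y1] ->
  {within `[x0, x1], continuous (fun x => f (x, y))}.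
Proof.
move=> cf yI; have [v cv vf] := continuous_extension_rect x01 y01 cf.
apply: (@subspace_eq_continuous _ _ _ (fun x => v (x, y))).
  by move=> x /[!inE]/= xI; rewrite vf.
exact/continuous_subspaceT/continuous_pairl.
Qed.

Lemma within_continuous_pairr (T : topologicalType) (f : R * R -> T) (x : R) :
  {within closure Omega, continuous f} -> x \in `[x0, x1] ->
  {within `[y0, y1], continuous (fun y => f (x, y))}.
Proof.
move=> cf xI; have [v cv vf] := continuous_extension_rect x01 y01 cf.
apply: (@subspace_eq_continuous _ _ _ (fun y => v (x, y))).
  by move=> y /[!inE]/= yI; rewrite vf.
exact/continuous_subspaceT/continuous_pairr.
Qed.

Lemma Rintegral_open_rect (f : R * R -> R) :
  {within closure Omega, continuous f} ->
  \int[(mu \x mu)%E]_(p in Omega) f p =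
  \int[mu]_(y in `]y0, y1[) \int[mu]_(x in `]x0, x1[) f (x, y).
Proof.
move=> cf; have [v cv vf] := continuous_extension_rect x01 y01 cf.
(* [f] is controlled only on the closure, so Fubini's theorem is applied to its everywhere
   continuous extension [v]. *)
transitivity (\int[(mu \x mu)%E]_(p in Omega) v p).
  apply: eq_Rintegral => -[x y] /[!inE] -[/= xI yI].
  by rewrite vf//; exact: subset_itv_oo_cc.
rewrite (@Rintegral_rect2 R v x0 x1 y0 y1)//; try exact: subset_itv_oo_cc.
apply: eq_Rintegral => y /[!inE]/= yI.
apply: eq_Rintegral => x /[!inE]/= xI.
by rewrite vf//; exact: subset_itv_oo_cc.
Qed.

Lemma within_continuous_side_difference (u : R * R -> R * R) :
  {within closure Omega, continuous u} ->
  {within `[y0, y1], continuous (side_difference x0 x1 u)}.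
Proof.
move=> cu; have x0I : x0 \in `[x0, x1] by rewrite in_itv/= lexx ltW.
have x1I : x1 \in `[x0, x1] by rewrite in_itv/= lexx ltW.
move=> y; apply: cvgB.
  exact: (continuous_fst_comp (within_continuous_pairr cu x1I)).
exact: (continuous_fst_comp (within_continuous_pairr cu x0I)).
Qed.

Lemma vertical_flux (u : R * R -> R * R) (c d : R) :
  C1_closure Omega u -> (forall p, Omega p -> divergence u p = 0) ->
  y0 <= c -> c < d -> d <= y1 ->
  \int[mu]_(x in `]x0, x1[) (u (x, d)).2 -
  \int[mu]_(x in `]x0, x1[) (u (x, c)).2 =
  - \int[mu]_(y in `[c, d]) side_difference x0 x1 u y.
Proof.
move=> [cu du [wx [cwx wxE]] [wy [cwy wyE]]] div0 y0c cd dy1.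
(* [vx] and [vy] are continuous on the whole plane and coincide with the partial derivatives of [u]
   inside [Omega]; they replace these derivatives in every integral below. *)
have [vx cvx vxE] := continuous_extension_rect x01 y01 cwx.
have [vy cvy vyE] := continuous_extension_rect x01 y01 cwy.
have cp : continuous (fst \o vx).
  exact: continuous_fst_comp.
have cq : continuous (snd \o vy).
  exact: continuous_snd_comp.
have cdI y : y \in `[c, d] -> y \in `[y0, y1].
  rewrite !in_itv/= => /andP[cy yd].
  by rewrite (le_trans y0c cy) (le_trans yd dy1).
have ooI (a b z : R) : a < z < b -> z \in `[a, b].
  by move=> azb; apply: subset_itv_oo_cc; rewrite in_itv.
have Om x y : x0 < x < x1 -> y0 < y < y1 -> Omega (x, y).
  by move=> xI yI; split; rewrite /= in_itv.
have cdo y : c < y < d -> y0 < y < y1.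
  by move=> /andP[cy yd]; rewrite (le_lt_trans y0c cy) (lt_le_trans yd dy1).
have vertical x : x0 < x < x1 ->
    \int[mu]_(y in `[c, d]) (vy (x, y)).2 = (u (x, d)).2 - (u (x, c)).2.
  move=> xI; apply: (@Rintegral_is_derive R _ (fun y => (u (x, y)).2)) => //.
  - exact/continuous_subspaceT/(continuous_pairr cq).
  - apply: (@continuous_subspaceW _ _ _ `[y0, y1]%classic); first exact: cdI.
    exact: (continuous_snd_comp (within_continuous_pairr cu (ooI _ _ _ xI))).
  - move=> y /cdo yI; rewrite vyE ?ooI// wyE; last exact: Om.
    by apply: is_derive_snd_pairr; apply: (du _ (Om _ _ xI yI)).2.
have horizontal y : y0 < y < y1 ->
    \int[mu]_(x in `[x0, x1]) (vx (x, y)).1 = side_difference x0 x1 u y.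
  move=> yI; apply: (@Rintegral_is_derive R _ (fun x => (u (x, y)).1)) => //.
  - exact/continuous_subspaceT/(continuous_pairl cp).
  - exact: (continuous_fst_comp (within_continuous_pairl cu (ooI _ _ _ yI))).
  - move=> x xI; rewrite vxE ?ooI// wxE; last exact: Om.
    by apply: is_derive_fst_pairl; apply: (du _ (Om _ _ xI yI)).1.
(* Incompressibility, carried over to the extensions. *)
have opp x y : x0 < x < x1 -> y0 < y < y1 -> (vy (x, y)).2 = - (vx (x, y)).1.
  move=> xI yI; rewrite vyE ?ooI// vxE ?ooI//.
  rewrite wyE ?wxE; [|exact: Om|exact: Om].
  by apply/eqP; rewrite -addr_eq0 addrC; apply/eqP/div0/Om.
have cux y : y \in `[y0, y1] ->
    {within `[x0, x1], continuous (fun x => (u (x, y)).2)}.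
  by move=> yI; exact: (continuous_snd_comp (within_continuous_pairl cu yI)).
rewrite -RintegralB//; last 2 first.
- apply: (integrable_within_continuous (cux d _)) => //.
    by apply: cdI; rewrite in_itv/= lexx ltW.
  exact: subset_itv_oo_cc.
- apply: (integrable_within_continuous (cux c _)) => //.
    by apply: cdI; rewrite in_itv/= lexx ltW.
  exact: subset_itv_oo_cc.
transitivity (\int[mu]_(x in `]x0, x1[) \int[mu]_(y in `]c, d[) (vy (x, y)).2).
  apply: eq_Rintegral => x /[!inE]/=; rewrite in_itv/= => xI.
  rewrite -vertical// Rintegral_itvoo_itvcc//.
  apply: (@integrable_within_continuous _ _ c d) => //.
    exact/continuous_subspaceT/(continuous_pairr cq).
  exact: subset_itv_oo_cc.
(* The order of integration is exchanged through the double integral, so that the horizontal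
   integral becomes the inner one. *)
rewrite -(@Rintegral_rect1 R (snd \o vy) x0 x1 c d)//;
  try exact: subset_itv_oo_cc.
rewrite (@Rintegral_rect2 R (snd \o vy) x0 x1 c d)//;
  try exact: subset_itv_oo_cc.
have cD : {within `[c, d], continuous (side_difference x0 x1 u)}.
  apply: (@continuous_subspaceW _ _ _ `[y0, y1]%classic); first exact: cdI.
  exact: within_continuous_side_difference.
rewrite -[RHS]mulN1r -RintegralZl//; last first.
  exact: (integrable_within_continuous cD).
(* The slab may touch the edges [y0] and [y1], while [horizontal] holds strictly between them; hence
   the passage to the open interval. *)
rewrite (@eq_Rintegral_itvoo _ _
  (fun y => -1 * side_difference x0 x1 u y) c d) //; last first.
  by move=> y; apply: cvgM; [exact: cvg_cst|exact: cD].
apply: eq_Rintegral => y /[!inE]/=; rewrite in_itv/= => /cdo yI.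
rewrite -horizontal// -Rintegral_itvoo_itvcc; last first.
  apply: (@integrable_within_continuous _ _ x0 x1) => //.
    exact/continuous_subspaceT/(continuous_pairl cp).
  exact: subset_itv_oo_cc.
rewrite -RintegralZl//; last first.
  apply: (@integrable_within_continuous _ _ x0 x1) => //.
    exact/continuous_subspaceT/(continuous_pairl cp).
  exact: subset_itv_oo_cc.
apply: eq_Rintegral => x /[!inE]/=; rewrite in_itv/= => xI.
by rewrite mulN1r opp.
Qed.

End rectangle.

(** * Mean vertical velocity from the exterior data *)

Theorem mainTheorem4 (R : realType) (x0 x1 a b t : R)
    (hx : x0 < x1) (hab : a < b) (hbt : b < t)
    (uS uB g : R * R -> R * R) :
  let L := x1 - x0 in
  let h := b - a in
  let OmegaB := open_rect x0 x1 a b in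
  let OmegaS := open_rect x0 x1 b t in
  let Dg := side_difference x0 x1 g in
  C1_closure OmegaS uS ->
  C1_closure OmegaB uB ->
  (forall p, OmegaS p -> divergence uS p = 0) ->
  (forall p, OmegaB p -> divergence uB p = 0) ->
  (forall x, x0 < x < x1 -> (uS (x, b)).2 = (uB (x, b)).2) ->
  (forall x, x0 < x < x1 -> uS (x, t) = g (x, t)) ->
  (forall y, b < y < t -> uS (x0, y) = g (x0, y) /\ uS (x1, y) = g (x1, y)) ->
  (forall y, a < y < b -> uB (x0, y) = g (x0, y) /\ uB (x1, y) = g (x1, y)) ->
  (L * h)^-1 *
      \int[(lebesgue_measure \x lebesgue_measure)%E]_(p in OmegaB) (uB p).2 =
    L^-1 * \int[lebesgue_measure]_(x in `[x0, x1]) (g (x, t)).2 +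
    L^-1 * \int[lebesgue_measure]_(s in `[b, t]) Dg s +
    (L * h)^-1 * \int[lebesgue_measure]_(s in `[a, b]) ((s - a) * Dg s).
Proof.
move=> L h OmegaB OmegaS Dg C1S C1B divS divB interface topS sideS sideB.
have cuS : {within closure OmegaS, continuous uS} by case: C1S.
have cuB : {within closure OmegaB, continuous uB} by case: C1B.
have cDS := within_continuous_side_difference hx hbt cuS.
have cDB := within_continuous_side_difference hx hab cuB.
(* [VS] and [VB] are the vertical fluxes through the horizontal segment at height [y], one for each
   field. *)
pose VS y := \int[lebesgue_measure]_(x in `]x0, x1[) (uS (x, y)).2.
pose VB y := \int[lebesgue_measure]_(x in `]x0, x1[) (uB (x, y)).2.
have -> : \int[lebesgue_measure]_(x in `[x0, x1]) (g (x, t)).2 = VS t.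
  apply: eq_Rintegral_itvoo => [|x xI]; last by rewrite topS.
  have tI : t \in `[b, t] by rewrite in_itv/= lexx ltW.
  exact: (continuous_snd_comp (within_continuous_pairl hx hbt cuS tI)).
(* Flux balance over the whole upper rectangle; [g] is tied to [uS] on the sides only for heights
   strictly between [b] and [t], which suffices up to a null set. *)
have -> : \int[lebesgue_measure]_(s in `[b, t]) Dg s = VS b - VS t.
  rewrite (eq_Rintegral_itvoo cDS); last first.
    by move=> y /sideS[e0 e1]; rewrite /Dg /side_difference e0 e1.
  rewrite Rintegral_itvoo_itvcc; last first.
    by apply: (integrable_within_continuous cDS) => //; exact: subset_itv_oo_cc.
  by rewrite -opprB (vertical_flux hx hbt C1S divS)// opprK.
have VBS : VB b = VS b.
  apply: eq_Rintegral => x /[!inE]/=; rewrite in_itv/= => xI.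
  by rewrite interface.
have -> : \int[(lebesgue_measure \x lebesgue_measure)%E]_(p in OmegaB) (uB p).2
    = \int[lebesgue_measure]_(y in `]a, b[) VB y.
  exact: (Rintegral_open_rect hx hab (continuous_snd_comp cuB)).
have -> : \int[lebesgue_measure]_(s in `[a, b]) ((s - a) * Dg s) =
    \int[lebesgue_measure]_(s in `]a, b[) ((s - a) * side_difference x0 x1 uB s).
  apply: eq_Rintegral_itvoo => [y|y /sideB[e0 e1]].
    by apply: cvgM; [exact: within_continuous_subr|exact: cDB].
  by rewrite /Dg /side_difference e0 e1.
(* The required increments of [VB] are the flux balances over the slabs from [a] to [y] in the lower
   rectangle. *)
rewrite (Rintegral_primitive hab cDB); last first.
  by move=> y ay yb; exact: (vertical_flux hx hab C1B divB).
(* The top flux [VS t] cancels on the right, and the factor [h] in front of the interface flux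
   cancels on the left; the side conditions are that the width and the height are nonzero. *)
rewrite VBS /h /L; field.
by rewrite !subr_eq0 !gt_eqF.
Qed.
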